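(* Let $d,k$ be positive integers. (a) If there is a system of $\binom{k+1}{2}$ equiangular lines in $\mathbb{R}^k$ and $d\equiv -k\pmod{\binom{k+1}{2}}$, then $\operatorname{off}_\mathbb{R}(d,k)=\theta_\mathbb{R}(d,k)=\frac{1}{\alpha_k(d+k)-1}$, where $\alpha_k=\frac{(k-1)\sqrt{k+2}+2}{k(k+1)}$. (b) If there is a system of $k^2$ equiangular lines in $\mathbb{C}^k$ and $d\equiv -k\pmod{k^2}$, then $\operatorname{off}_\mathbb{C}(d,k)=\theta_\mathbb{C}(d,k)=\frac{1}{\alpha^*_k(d+k)-1}$, where $\alpha^*_k=\frac{(k-1)\sqrt{k+1}+1}{k^2}$.
   Context: Let $\mathbb{F}\in\{\mathbb{R},\mathbb{C}\}$. For a matrix $A\in\mathbb{F}^{n\times n}$, $\operatorname{off}(A):=\max_{i\neq j}|A_{ij}|$. For positive integers $d,k$: $\theta_\mathbb{F}(d,k):=\min \max_{i\neq j}|\langle x_i,x_j\rangle|$, the minimum over all choices of $d+k$ unit vectors $x_1,\dots,x_{d+k}\in\mathbb{F}^d$ (equivalently, the minimum of $\operatorname{off}(A)$ over Hermitian positive semidefinite $A\in\mathbb{F}^{(d+k)\times(d+k)}$ of rank $d$ with all diagonal entries $1$); and $\operatorname{off}_\mathbb{F}(d,k):=\min_A \operatorname{off}(A)$ over all $A\in\mathbb{F}^{(d+k)\times(d+k)}$ with $\operatorname{rank}(A)=d$ and $A_{ii}=1$ for all $i$. A system of equiangular lines in $\mathbb{F}^k$ is a set $X$ of unit vectors in $\mathbb{F}^k$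 for which there is $\beta\in\mathbb{R}$ with $|\langle x,y\rangle|=\beta$ for all distinct $x,y\in X$. *)

(* Defs.v *)
From mathcomp Require Import all_boot all_order all_algebra.
From mathcomp Require Import classical_sets reals.
From mathcomp Require Import complex.

Set Implicit Arguments.
Unset Strict Implicit.
Unset Printing Implicit Defensive.

Import Order.TTheory GRing.Theory Num.Theory.
Local Open Scope classical_set_scope.
Local Open Scope ring_scope.

(* F is R or R[i] (R : realType), and theta is the conjugation of F: idfun on
   R, Num.conj on R[i]. Moduli `|z| are elements of F; in R[i] they are real. *)

Definition is_min (T : numDomainType) (S : set T) (m : T) : Prop :=
  S m /\ lbound S m.

(* \sum_i u_i * theta (v_i), as the trace of a 1 x 1 matrix; for Num.conj this
   is dotmx of the library. *)
Definition inner (F : numFieldType) (theta : {rmorphism F -> F}) (n : nat)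
    (u v : 'rV[F]_n) : F :=
  form_of_matrix theta 1%:M u v.

(* The maximum of the empty family (n <= 1) is 0. *)
Definition off (F : numFieldType) (n : nat) (A : 'M[F]_n) : F :=
  \big[Num.max/0]_(p : 'I_n * 'I_n | p.1 != p.2) `|A p.1 p.2|.

Definition is_off (F : numFieldType) (d k : nat) (m : F) : Prop :=
  is_min [set off A | A in [set A : 'M[F]_(d + k) |
                            \rank A = d /\ forall i, A i i = 1]] m.
Arguments is_off : clear implicits.

Definition is_theta (F : numFieldType) (theta : {rmorphism F -> F})
    (d k : nat) (m : F) : Prop :=
  is_min [set off (\matrix_(i, j) inner theta (x i) (x j)) |
           x in [set x : 'I_(d + k) -> 'rV[F]_d |
                 forall i, inner theta (x i) (x i) = 1]] m.

(* The vectors must span pairwise distinct lines. Otherwise beta = 1 would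
   admit any number of unimodular multiples of a single vector in R[i]^k. *)
Definition equiangular_lines (F : numFieldType) (theta : {rmorphism F -> F})
    (k N : nat) : Prop :=
  exists x : 'I_N -> 'rV[F]_k,
    [/\ forall i, inner theta (x i) (x i) = 1,
        forall i j, i != j -> ~~ (x i == x j)%MS
      & exists2 beta : F, beta \is Num.real &
          forall i j, i != j -> `|inner theta (x i) (x j)| = beta].

Definition alpha_real (R : realType) (k : nat) : R :=
  ((k%:R - 1) * Num.sqrt (k%:R + 2) + 2) / (k%:R * (k%:R + 1)).

Definition alpha_complex (R : realType) (k : nat) : R :=
  ((k%:R - 1) * Num.sqrt (k%:R + 1) + 1) / k%:R ^+ 2.

(* Main.v *)
Require Import Defs.
From mathcomp Require Import all_boot all_order all_algebra.
From mathcomp Require Import classical_sets reals.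
From mathcomp Require Import complex ring.

(* Put n = d + k.  Lower bound: if A has rank at most d and unit diagonal, let P
   be an orthogonal projection of rank k with P A = 0.  Then tr (P A) = 0 gives
   k <= off A * (\sum_(i, j) |P i j| - k), so it suffices to show
   \sum_(i, j) |P i j| <= alpha k n.  Write |P i j| = r_i r_j u_ij with
   r_i ^ 2 = P i i, and use u <= a + b u^2 - c u^4 on [0, 1], where the
   right-hand side is tangent to u at the common angle be of the lines and meets
   it at 1.  The three resulting sums are controlled by
   \sum r_i r_j <= n k, by \sum |P i j|^2 / (r_i r_j) <= n (AM-GM and P^2 = P),
   and by the second-order Welch bound, which holds for arbitrary weights.

   Upper bound: the rank-one projections of N = dim equiangular lines form a
   basis of the space of Hermitian (symmetric) matrices; expanding the identity
   in it shows that the lines form a tight frame with the expected angle.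
   Repeating each line n / N times gives a Gram matrix G, and an affine
   combination of 1, G and the coincidence matrix of the repetitions is positive
   semidefinite of rank d and attains the bound. *)

Set Implicit Arguments.
Unset Strict Implicit.
Unset Printing Implicit Defensive.

Import Order.TTheory GRing.Theory Num.Theory.
Local Open Scope ring_scope.
Local Open Scope complex_scope.

(** * Hermitian matrices over a field with conjugation *)

Section Conjugation.
Variables (F : numFieldType) (theta : {rmorphism F -> F}).
(** The identity through which [idfun] on the reals and conjugation on [R[i]] are treated at
    once. *)
Hypothesis thetaM : forall x, x * theta x = `|x| ^+ 2.
Local Notation "A ^H" := (map_mx theta A^T) (at level 8, format "A ^H").

Lemma theta_ge0 x : 0 <= x -> theta x = x.
Proof.
move=> x0; have [->|xN0] := eqVneq x 0; first by rewrite rmorph0.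
by apply: (mulfI xN0); rewrite thetaM ger0_norm // expr2.
Qed.

Lemma thetaK : involutive theta.
Proof.
move=> x; have [->|xN0] := eqVneq x 0; first by rewrite !rmorph0.
have tN0 : theta x != 0 by rewrite fmorph_eq0.
apply: (mulfI tN0); rewrite -rmorphM thetaM (theta_ge0 (exprn_ge0 _ _)) //.
by rewrite -thetaM mulrC.
Qed.

Lemma norm_theta x : `|theta x| = `|x|.
Proof.
apply: (@pexpIrn _ 2%N) => //; rewrite ?nnegrE //.
by rewrite -thetaM thetaK mulrC thetaM.
Qed.

Lemma adjE m n (A : 'M[F]_(m, n)) i j : A^H i j = theta (A j i).
Proof. by rewrite !mxE. Qed.

Lemma adjK m n (A : 'M[F]_(m, n)) : A^H^H = A.
Proof. by apply/matrixP => i j; rewrite !adjE thetaK. Qed.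

Lemma adjM m n p (A : 'M[F]_(m, n)) (B : 'M[F]_(n, p)) :
  (A *m B)^H = B^H *m A^H.
Proof. by rewrite trmx_mul map_mxM. Qed.

Lemma adjD m n (A B : 'M[F]_(m, n)) : (A + B)^H = A^H + B^H.
Proof. by rewrite linearD map_mxD. Qed.

Lemma mul_adj_diag m n (A : 'M[F]_(m, n)) i :
  (A *m A^H) i i = \sum_j `|A i j| ^+ 2.
Proof. by rewrite mxE; apply: eq_bigr => j _; rewrite adjE thetaM. Qed.

Lemma mul_adj_eq0 m n (A : 'M[F]_(m, n)) : A *m A^H = 0 -> A = 0.
Proof.
move=> A0; apply/matrixP => i j; rewrite [RHS]mxE.
have /eqP := mul_adj_diag A i; rewrite A0 mxE eq_sym psumr_eq0; last first.
  by move=> l _; apply: exprn_ge0.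
move=> /allP/(_ j); rewrite mem_index_enum expf_eq0 normr_eq0 /=.
by move=> /(_ isT)/eqP.
Qed.

Lemma innerE n (u v : 'rV[F]_n) : inner theta u v = (u *m v^H) 0 0.
Proof. by rewrite /inner /form_of_matrix mulmx1 trace_mx11. Qed.

Lemma inner_sum n (u v : 'rV[F]_n) :
  inner theta u v = \sum_j u 0 j * theta (v 0 j).
Proof. by rewrite innerE mxE; apply: eq_bigr => j _; rewrite adjE. Qed.

Lemma inner_row m n (A B : 'M[F]_(m, n)) i j :
  inner theta (row i A) (row j B) = (A *m B^H) i j.
Proof. by rewrite inner_sum mxE; apply: eq_bigr => l _; rewrite adjE !mxE. Qed.

(** A square root of nonnegative elements: [Num.sqrt] over R, [sqrtC] over [R[i]]. *)
Variable sq : F -> F.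
Hypothesis sq_ge0 : forall x, 0 <= x -> 0 <= sq x.
Hypothesis sqK : forall x, 0 <= x -> sq x ^+ 2 = x.

(* Gram-Schmidt: split off the orthogonal projection of the rows of [B] onto one
   vector of the row space of [B], then recurse on the remainder [B']. *)
Lemma gram_factor d m n (B : 'M[F]_(m, n)) :
  (\rank B <= d)%N -> exists X : 'M[F]_(m, d), X *m X^H = B *m B^H.
Proof.
elim: d B => [|d IHd] B.
  rewrite leqn0 mxrank_eq0 => /eqP ->.
  by exists 0; rewrite !mul0mx.
have [B0 _|/rowV0Pn[v vB vN0]] := eqVneq B 0.
  by exists 0; rewrite B0 !mul0mx.
move=> rB; pose s := sq ((v *m v^H) 0 0).
have vv_ge0 : 0 <= (v *m v^H) 0 0.
  by rewrite mul_adj_diag; apply: sumr_ge0 => j _; apply: exprn_ge0.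
have vv : v *m v^H = (s ^+ 2)%:M by rewrite [LHS]mx11_scalar sqK.
have sN0 : s != 0.
  apply: contra vN0 => /eqP s0; apply/eqP/mul_adj_eq0.
  by rewrite vv s0 expr0n /= raddf0.
have ts : theta s = s by rewrite theta_ge0 // sq_ge0.
pose e := s^-1 *: v.
have eH : e^H = s^-1 *: v^H by rewrite linearZ /= map_mxZ fmorphV /= ts.
have ee : e *m e^H = 1%:M.
  rewrite eH -scalemxAl -scalemxAr vv scalerA scale_scalar_mx.
  by congr (_%:M); rewrite -invfM -expr2 mulVf // expf_neq0.
pose B' := B - B *m e^H *m e.
have B'e : B' *m e^H = 0.
  by rewrite mulmxBl -(mulmxA (B *m e^H)) ee mulmx1 subrr.
have eB : (e <= B)%MS by apply: scalemx_sub.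
(* The rank drops: [e] lies in the row space of [B], but the rows of [B'] are orthogonal to [e]. *)
have B'B : (B' < B)%MS.
  rewrite /ltmx {1}/B' -mulNmx addmx_sub ?mulmx_sub //=.
  apply/negP => /(submx_trans eB) /submxP[D eD].
  have : e *m e^H = 0 by rewrite -(mulmx0 _ D) -B'e mulmxA -eD.
  by rewrite ee => /matrixP/(_ 0 0)/eqP; rewrite !mxE oner_eq0.
have [|X XB] := IHd B'.
  by move: B'B; rewrite ltmxErank => /andP[_ ltB]; rewrite -ltnS (leq_trans ltB).
exists (row_mx (B *m e^H) X).
have -> : row_mx (B *m e^H) X *m (row_mx (B *m e^H) X)^H =
    (B *m e^H) *m (B *m e^H)^H + X *m X^H.
  by rewrite tr_row_mx map_col_mx mul_row_col.
rewrite XB.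
have BE : B = B' + B *m e^H *m e by rewrite subrK.
have eB' : e *m B'^H = 0.
  by rewrite -(adjK e) -adjM B'e trmx0 map_mx0.
clearbody B'; move: (B *m e^H) BE => c ->.
rewrite adjD adjM mulmxDl !mulmxDr -!(mulmxA c e) eB' mulmx0 add0r.
by rewrite !mulmxA B'e mul0mx addr0 -(mulmxA c) ee mulmx1 addrC.
Qed.

(** [K^H (K K^H)^-1 K] projects orthogonally onto the row space of [K]; [K K^H] is invertible, as
    [y K K^H = 0] gives [(y K) (y K)^H = 0], so [y K = 0]. *)
Lemma proj_row_free k n (K : 'M[F]_(k, n)) : row_free K ->
  exists2 P : 'M[F]_n, [/\ P *m P = P, P^H = P & \tr P = k%:R]
    & exists D, P = D *m K.
Proof.
move=> freeK; pose M := K *m K^H.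
have MH : M^H = M by rewrite /M adjM adjK.
have uM : M \in unitmx.
  rewrite -row_free_unit -kermx_eq0; apply/eqP/(row_free_inj freeK).
  rewrite mul0mx; apply: mul_adj_eq0; rewrite adjM mulmxA -[_ *m K *m _]mulmxA.
  by rewrite mulmx_ker mul0mx.
have iMH : (invmx M)^H = invmx M by rewrite trmx_inv map_invmx MH.
exists (K^H *m invmx M *m K); last by exists (K^H *m invmx M).
split.
- rewrite !mulmxA; congr (_ *m K).
  by rewrite -[_ *m K *m _]mulmxA -[_ *m invmx M *m _]mulmxA mulVmx // mulmx1.
- by rewrite !adjM adjK iMH mulmxA.
- by rewrite mxtrace_mulC mulmxA mulmxV // mxtrace1.
Qed.

(** The order of [F] may be partial; [Num.max] is under control because nonnegative elements are
    comparable. *)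
Lemma le_bigmax_ge0 (I : eqType) (s : seq I) (P : pred I) (f : I -> F) :
  (forall i, 0 <= f i) ->
  0 <= \big[Num.max/0]_(i <- s | P i) f i /\
  forall i, i \in s -> P i -> f i <= \big[Num.max/0]_(j <- s | P j) f j.
Proof.
move=> f0; elim: s => [|x s [IH0 IH]]; first by rewrite big_nil.
have cmp : (f x >=< \big[Num.max/0]_(j <- s | P j) f j)%O.
  by apply: real_comparable; apply: ger0_real.
rewrite big_cons; case: ifP => Px; split => //.
- by rewrite comparable_le_max // f0.
- move=> i; rewrite in_cons => /orP[/eqP -> _|si Pi];
    by rewrite comparable_le_max // ?lexx // IH ?orbT.
- by move=> i; rewrite in_cons => /orP[/eqP ->|]; [rewrite Px | apply: IH].
Qed.

Lemma off_ge0 n (A : 'M[F]_n) : 0 <= off A.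
Proof.
by have [] := le_bigmax_ge0 (index_enum _)
  (fun p : 'I_n * 'I_n => p.1 != p.2) (fun p => normr_ge0 (A p.1 p.2)).
Qed.

Lemma le_off n (A : 'M[F]_n) i j : i != j -> `|A i j| <= off A.
Proof.
move=> ij; have [_ /(_ (i, j))] := le_bigmax_ge0 (index_enum _)
  (fun p : 'I_n * 'I_n => p.1 != p.2) (fun p => normr_ge0 (A p.1 p.2)).
by apply => //; rewrite mem_index_enum.
Qed.

Lemma off_le n (A : 'M[F]_n) c :
  0 <= c -> (forall i j, i != j -> `|A i j| <= c) -> off A <= c.
Proof.
move=> c0 Ac; rewrite /off; elim/big_ind: _ => // [x y xc yc|p]; last exact: Ac.
by rewrite /Num.max; case: ifP.
Qed.

(** * Entries of an orthogonal projection *)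

Lemma mulmx_idem_sum n (P : 'M[F]_n) i j :
  P *m P = P -> \sum_l P i l * P l j = P i j.
Proof. by move=> PP; rewrite -[in RHS]PP mxE. Qed.

Section Projection.
Variables (n : nat) (P : 'M[F]_n).
Hypotheses (PP : P *m P = P) (PH : P^H = P).

Lemma proj_adj i j : theta (P i j) = P j i.
Proof. by rewrite -adjE PH. Qed.

Lemma proj_normsq i j : P i j * P j i = `|P i j| ^+ 2.
Proof. by rewrite -(proj_adj i j) thetaM. Qed.

Lemma proj_diag i : P i i = \sum_j `|P i j| ^+ 2.
Proof.
rewrite -(mulmx_idem_sum i i PP); apply: eq_bigr => j _.
by rewrite proj_normsq.
Qed.

Lemma proj_diag_ge0 i : 0 <= P i i.
Proof. by rewrite proj_diag sumr_ge0 // => j _; rewrite exprn_ge0. Qed.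

Lemma proj_normC i j : `|P i j| = `|P j i|.
Proof. by rewrite -(proj_adj i j) norm_theta. Qed.

(** Cauchy-Schwarz for the rows of [P], whose Gram matrix is [P] itself since [P P^H = P]. *)
Lemma proj_cauchy i j : `|P i j| ^+ 2 <= P i i * P j j.
Proof.
have Pj0 := proj_diag_ge0 j.
have [Pj|PjN0] := eqVneq (P j j) 0.
  have : P j i = 0.
    have /eqP := proj_diag j; rewrite Pj eq_sym psumr_eq0; last first.
      by move=> l _; apply: exprn_ge0.
    move=> /allP/(_ i); rewrite mem_index_enum expf_eq0 normr_eq0 /=.
    by move=> /(_ isT)/eqP.
  by rewrite proj_normC => ->; rewrite normr0 expr0n Pj mulr0.
have Pj_gt0 : 0 < P j j by rewrite lt_def PjN0.
have : 0 <= \sum_l `|P j j * P i l - P i j * P j l| ^+ 2.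
  by apply: sumr_ge0 => l _; apply: exprn_ge0.
have -> : \sum_l `|P j j * P i l - P i j * P j l| ^+ 2 =
   P j j * (P i i * P j j - `|P i j| ^+ 2).
  transitivity (\sum_l (P j j ^+ 2 * (P i l * P l i)
     - P j j * P j i * (P i l * P l j) - P j j * P i j * (P j l * P l i)
     + P i j * P j i * (P j l * P l j))).
    apply: eq_bigr => l _; rewrite -thetaM rmorphB !rmorphM /= !proj_adj; ring.
  rewrite big_split !sumrB -!mulr_sumr /= !mulmx_idem_sum // -proj_normsq; ring.
by rewrite pmulr_rge0 // subr_ge0.
Qed.

End Projection.

Lemma off_proj_lower d k n (A : 'M[F]_n) S :
  n = (d + k)%N -> (\rank A <= d)%N -> (forall i, A i i = 1) ->
  (forall P : 'M[F]_n, P *m P = P -> P^H = P -> \tr P = k%:R ->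
     \sum_i \sum_j `|P i j| <= S) ->
  k%:R <= off A * (S - k%:R).
Proof.
move=> nE rA A1 HS.
have rk : (k <= \rank (kermx A))%N 
  by rewrite mxrank_ker leq_subRL ?rank_leq_row // [leqRHS]nE leq_add2r.
have [K freeK KA] : exists2 K : 'M[F]_(k, n), row_free K & K *m A = 0.
  exists (pid_mx k *m row_base (kermx A)).
    rewrite /row_free mxrankMfree ?row_base_free // rank_pid_mx //.
  by apply/sub_kermxP; rewrite (submx_trans (submxMl _ _)) // eq_row_base.
have [P [PP PH Ptr] [D PE]] := proj_row_free freeK.
have PA : P *m A = 0 by rewrite PE -mulmxA KA mulmx0.
have diag0 i : 0 <= P i i := proj_diag_ge0 PP PH i.
have := HS P PP PH Ptr.
have splitP : \sum_i \sum_j `|P i j| = k%:R + \sum_i \sum_(j | j != i) `|P i j|.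
  rewrite -Ptr /mxtrace -big_split; apply: eq_bigr => i _.
  by rewrite (bigD1 i) //= ger0_norm.
rewrite splitP -lerBrDl => leS.
apply: le_trans (ler_wpM2l (off_ge0 A) leS).
have /eqP : \tr (P *m A) = 0 by rewrite PA mxtrace0.
have -> : \tr (P *m A) = k%:R + \sum_i \sum_(j | j != i) P i j * A j i.
  rewrite -Ptr /mxtrace -big_split; apply: eq_bigr => i _.
  by rewrite mxE (bigD1 i) //= A1 mulr1.
rewrite addr_eq0 => /eqP kE.
rewrite -[k%:R]ger0_norm ?ler0n // kE normrN mulr_sumr.
apply: le_trans (ler_norm_sum _ _ _) _; apply: ler_sum => i _.
rewrite mulr_sumr; apply: le_trans (ler_norm_sum _ _ _) _.
apply: ler_sum => j ji; rewrite normrM mulrC ler_wpM2r // le_off //.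
Qed.

(** * Welch bounds *)

(** Expand the squared Hilbert-Schmidt norm of [tau * S - L * T]; [tau] is the squared norm of
    [T]. *)
Lemma hilbert_schmidt_cauchy (I J : finType) (S T : I -> J -> F) L tau :
  0 <= L -> 0 < tau -> \sum_i \sum_j S i j * theta (T i j) = L ->
  \sum_i \sum_j T i j * theta (T i j) = tau ->
  L ^+ 2 <= tau * \sum_i \sum_j S i j * theta (S i j).
Proof.
move=> L0 tau0 SL Ttau.
have TS : \sum_i \sum_j T i j * theta (S i j) = L.
  rewrite -(theta_ge0 L0) -SL rmorph_sum; apply: eq_bigr => i _.
  rewrite rmorph_sum; apply: eq_bigr => j _.
  by rewrite rmorphM /= thetaK mulrC.
have : 0 <= \sum_i \sum_j `|tau * S i j - L * T i j| ^+ 2.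
  by do 2!apply: sumr_ge0 => ? _; apply: exprn_ge0.
have -> : \sum_i \sum_j `|tau * S i j - L * T i j| ^+ 2 =
  tau ^+ 2 * (\sum_i \sum_j S i j * theta (S i j))
  - tau * L * (\sum_i \sum_j S i j * theta (T i j))
  - tau * L * (\sum_i \sum_j T i j * theta (S i j))
  + L ^+ 2 * (\sum_i \sum_j T i j * theta (T i j)).
  rewrite !mulr_sumr -!sumrB -big_split; apply: eq_bigr => i _.
  rewrite !mulr_sumr -!sumrB -big_split; apply: eq_bigr => j _ /=.
  rewrite -thetaM rmorphB !rmorphM /= (theta_ge0 L0) (theta_ge0 (ltW tau0)).
  by ring.
rewrite SL TS Ttau; set SS := \sum_i _.
have -> : tau ^+ 2 * SS - tau * L * L - tau * L * L + L ^+ 2 * tau =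
  tau * (tau * SS - L ^+ 2) by ring.
by rewrite pmulr_rge0 // subr_ge0.
Qed.

(* Cauchy-Schwarz between [T] and the weighted frame operator
   [\sum_i w i * Y _ i * theta (Y _ i)]. *)
Lemma weighted_gram_bound (I J : finType) (Y : I -> J -> F) (w l : J -> F)
    (T : I -> I -> F) tau :
  (forall j, 0 <= w j) -> (forall j, 0 <= l j) -> 0 < tau ->
  (forall j, \sum_p Y p j * \sum_q theta (Y q j) * theta (T p q) = l j) ->
  \sum_p \sum_q T p q * theta (T p q) = tau ->
  (\sum_j w j * l j) ^+ 2 <=
    tau * \sum_i \sum_j w i * w j * `|\sum_p theta (Y p i) * Y p j| ^+ 2.
Proof.
move=> w0 l0 tau0 Yl Ttau.
pose S p q := \sum_i w i * Y p i * theta (Y q i).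
(* The weighted sum of squared inner products of the columns of [Y] is the squared Hilbert-Schmidt
   norm of the frame operator [S]. *)
have -> : \sum_i \sum_j w i * w j * `|\sum_p theta (Y p i) * Y p j| ^+ 2 =
    \sum_p \sum_q S p q * theta (S p q).
  transitivity (\sum_i \sum_j \sum_p \sum_q
     w i * w j * ((theta (Y p j) * Y p i) * (theta (Y q i) * Y q j))).
    apply: eq_bigr => i _; apply: eq_bigr => j _.
    rewrite -thetaM rmorph_sum [X in _ * X = _]mulrC big_distrlr mulr_sumr.
    apply: eq_bigr => p _; rewrite mulr_sumr; apply: eq_bigr => q _ /=.
    by rewrite rmorphM thetaK (mulrC (Y p i)).
  transitivity (\sum_p \sum_q \sum_i \sum_j
     w i * w j * ((theta (Y p j) * Y p i) * (theta (Y q i) * Y q j))).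
    under eq_bigr do rewrite exchange_big.
    rewrite exchange_big; apply: eq_bigr => p _.
    under eq_bigr do rewrite exchange_big.
    by rewrite exchange_big.
  apply: eq_bigr => p _; apply: eq_bigr => q _.
  rewrite rmorph_sum big_distrlr.
  apply: eq_bigr => i _; apply: eq_bigr => j _ /=.
  by rewrite !rmorphM thetaK (theta_ge0 (w0 j)); ring.
apply: (@hilbert_schmidt_cauchy _ _ S T) => //.
  by apply: sumr_ge0 => j _; apply: mulr_ge0.
transitivity (\sum_p \sum_j
    w j * (Y p j * \sum_q theta (Y q j) * theta (T p q))).
  apply: eq_bigr => p _.
  rewrite /S; under eq_bigr do rewrite mulr_suml.
  rewrite exchange_big; apply: eq_bigr => i _.
  by rewrite !mulr_sumr; apply: eq_bigr => q _; rewrite !mulrA.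
by rewrite exchange_big; apply: eq_bigr => j _; rewrite -mulr_sumr Yl.
Qed.

Lemma sum_pair_mul (I J : finType) (f : I -> F) (g : J -> F) :
  \sum_(p : I * J) f p.1 * g p.2 = (\sum_i f i) * (\sum_j g j).
Proof. by rewrite big_distrlr pair_bigA. Qed.

Section Welch.
Variables (n k : nat) (P : 'M[F]_n) (w : 'I_n -> F).
Hypotheses (k_gt0 : (0 < k)%N) (w_ge0 : forall i, 0 <= w i).
Hypotheses (PP : P *m P = P) (PH : P^H = P) (Ptr : \tr P = k%:R).

Let sumP i j := mulmx_idem_sum i j PP.

(** The tensor squares of the columns of [P] have inner products [P i j ^+ 2]; this is how the
    fourth powers arise. *)
Let sum_square i j : \sum_(p : 'I_n * 'I_n)
  theta (P p.1 i * P p.2 i) * (P p.1 j * P p.2 j) = P i j ^+ 2.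
Proof.
rewrite expr2 -{1}(sumP i j) -(sumP i j) -sum_pair_mul; apply: eq_bigr => p _.
by rewrite rmorphM /= !proj_adj // mulrACA.
Qed.

(* Twice the projection onto the symmetric square of the range of [P]. *)
Let sym (p q : 'I_n * 'I_n) := P p.1 q.1 * P p.2 q.2 + P p.1 q.2 * P p.2 q.1.

Let mul_sym p a b :
  \sum_(q : 'I_n * 'I_n) P q.1 a * P q.2 b * sym p q =
  P p.1 a * P p.2 b + P p.1 b * P p.2 a.
Proof.
rewrite (mulrC (P p.1 b)) -(sumP p.1 a) -(sumP p.2 b) -(sumP p.1 b) -(sumP p.2 a).
rewrite -!sum_pair_mul -big_split; apply: eq_bigr => q _ /=; rewrite /sym; ring.
Qed.

Let theta_sym p q : theta (sym p q) = sym q p.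
Proof.
by rewrite /sym rmorphD !rmorphM /= !proj_adj // [X in _ + X]mulrC.
Qed.

Let tr_idem_sum : \sum_i P i i = k%:R.
Proof. exact: Ptr. Qed.

Let sum_idem2 : \sum_i \sum_j P i j * P j i = k%:R.
Proof. by rewrite -Ptr; apply: eq_bigr => i _; rewrite sumP. Qed.

(** Four times [k (k + 1) / 2], since [sym] is twice a projection of that rank. *)
Let sum_symsym :
  \sum_p \sum_q sym p q * theta (sym p q) = 2 * (k%:R * (k%:R + 1)).
Proof.
transitivity (\sum_p 2 * sym p p).
  apply: eq_bigr => p _.
  transitivity (\sum_(q : 'I_n * 'I_n) (P q.1 p.1 * P q.2 p.2 * sym p q
      + P q.1 p.2 * P q.2 p.1 * sym p q)).
    by apply: eq_bigr => q _; rewrite theta_sym /sym; ring.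
  by rewrite big_split !mul_sym /= /sym; ring.
rewrite -mulr_sumr; congr (2 * _); rewrite big_split /=
  (sum_pair_mul (fun i => P i i) (fun i => P i i)) tr_idem_sum.
by rewrite -(pair_bigA _ (fun i j => P i j * P j i)) sum_idem2; ring.
Qed.

(** [weighted_gram_bound] for the tensor squares of the columns of [P], with [T = sym],
    [l i = 2 * P i i ^+ 2] and [tau = 2 k (k + 1)]. *)
Lemma welch_complex : 2 * (\sum_i w i * P i i ^+ 2) ^+ 2 <=
  k%:R * (k%:R + 1) * \sum_i \sum_j w i * w j * `|P i j| ^+ 4.
Proof.
have kR : 0 < k%:R :> F by rewrite ltr0n.
have k1 : 0 < k%:R * (k%:R + 1) :> F by rewrite mulr_gt0 // addr_gt0.
have -> : \sum_i \sum_j w i * w j * `|P i j| ^+ 4 = \sum_i \sum_j w i * w j *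
    `|\sum_p theta (P p.1 i * P p.2 i) * (P p.1 j * P p.2 j)| ^+ 2.
  apply: eq_bigr => i _; apply: eq_bigr => j _.
  by rewrite sum_square normrX -exprM.
have two_gt0 : 0 < 2 :> F by rewrite ltr0n.
rewrite -(ler_pM2l two_gt0) 2!(mulrA 2) -(expr2 2) -exprMn mulr_sumr.
under eq_bigr do rewrite mulrCA.
apply: weighted_gram_bound sum_symsym => // [i||i].
- by rewrite mulr_ge0 // exprn_ge0 // proj_diag_ge0.
- by rewrite mulr_gt0.
transitivity (\sum_(p : 'I_n * 'I_n)
    P p.1 i * P p.2 i * (2 * (P i p.1 * P i p.2))).
  apply: eq_bigr => p _; congr (_ * _).
  transitivity (theta (\sum_(q : 'I_n * 'I_n) P q.1 i * P q.2 i * sym p q)).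
    rewrite rmorph_sum; apply: eq_bigr => q _.
    by rewrite [theta (_ * sym _ _)]rmorphM.
  by rewrite mul_sym rmorphD rmorphM /= !proj_adj // mulrDl !mul1r.
rewrite -(sumP i i) expr2 -sum_pair_mul mulr_sumr; apply: eq_bigr => p _; ring.
Qed.

Section Real.
Hypothesis theta_id : forall x, theta x = x.

Let symP i j : P i j = P j i.
Proof. by rewrite -(proj_adj PH j i) theta_id. Qed.

Let sum_diag a b :
  \sum_(q : 'I_n * 'I_n) P q.1 a * P q.2 b * P q.1 q.2 = P a b.
Proof.
rewrite -(pair_bigA _ (fun i j => P i a * P j b * P i j)) -sumP.
apply: eq_bigr => i _; rewrite (symP a) -(sumP i b) mulr_sumr.
by apply: eq_bigr => j _; rewrite -mulrA (mulrC (P j b)).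
Qed.

(* For real [P] the contraction [P p.1 p.2 * P q.1 q.2] is also symmetric; adding
   it improves the constant from 2 / (k (k + 1)) to 3 / (k (k + 2)). *)
Let tensor (p q : 'I_n * 'I_n) := sym p q + P p.1 p.2 * P q.1 q.2.

Let mul_tensor p a b : \sum_(q : 'I_n * 'I_n) P q.1 a * P q.2 b * tensor p q =
  P p.1 a * P p.2 b + P p.1 b * P p.2 a + P p.1 p.2 * P a b.
Proof.
rewrite -mul_sym -[P a b]sum_diag mulr_sumr -big_split; apply: eq_bigr => q _ /=.
by rewrite /tensor mulrDr [P p.1 p.2 * (_ * _)]mulrCA.
Qed.

Let sum_square_diag : \sum_(q : 'I_n * 'I_n) P q.1 q.2 ^+ 2 = k%:R.
Proof.
rewrite -sum_idem2 pair_bigA; apply: eq_bigr => q _.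
by rewrite (symP q.2) expr2.
Qed.

Let mul_diag_tensor p : \sum_(q : 'I_n * 'I_n) P q.1 q.2 * tensor p q =
  (k%:R + 2) * P p.1 p.2.
Proof.
transitivity (\sum_(q : 'I_n * 'I_n) (P q.1 p.1 * P q.2 p.2 * P q.1 q.2 +
    P q.1 p.2 * P q.2 p.1 * P q.1 q.2 + P p.1 p.2 * P q.1 q.2 ^+ 2)).
  apply: eq_bigr => q _; rewrite /tensor /sym (symP p.1 q.1) (symP p.1 q.2).
  by rewrite (symP p.2 q.1) (symP p.2 q.2); ring.
by rewrite !big_split -mulr_sumr /= sum_square_diag !sum_diag (symP p.2); ring.
Qed.

(** On the symmetric square [tensor] has eigenvalue [k + 2] at the vector [P] and 2 on its
    complement, whence [4 (k (k + 1) / 2 - 1) + (k + 2) ^ 2 = 3 k (k + 2)]. *)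
Let sum_tensor2 :
  \sum_p \sum_q tensor p q * theta (tensor p q) = 3 * (k%:R * (k%:R + 2)).
Proof.
transitivity (\sum_p (2 * sym p p + (k%:R + 4) * P p.1 p.2 ^+ 2)).
  apply: eq_bigr => p _.
  transitivity (\sum_(q : 'I_n * 'I_n) (P q.1 p.1 * P q.2 p.2 * tensor p q
      + P q.1 p.2 * P q.2 p.1 * tensor p q
      + P p.1 p.2 * (P q.1 q.2 * tensor p q))).
    apply: eq_bigr => q _; rewrite theta_id {2}/tensor /sym.
    by rewrite (symP q.1 p.1) (symP q.1 p.2) (symP q.2 p.1) (symP q.2 p.2); ring.
  rewrite !big_split -mulr_sumr !mul_tensor mul_diag_tensor /= /sym.
  by rewrite (symP p.2 p.1); ring.
rewrite big_split -!mulr_sumr /= sum_square_diag big_split /=.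
rewrite (sum_pair_mul (fun i => P i i) (fun i => P i i)) tr_idem_sum.
by rewrite -(pair_bigA _ (fun i j => P i j * P j i)) sum_idem2; ring.
Qed.

(** The argument of [welch_complex] with [T = tensor]: the contraction raises [l i] to
    [3 * P i i ^+ 2] and [tau] to [3 k (k + 2)]. *)
Lemma welch_real : 3 * (\sum_i w i * P i i ^+ 2) ^+ 2 <=
  k%:R * (k%:R + 2) * \sum_i \sum_j w i * w j * `|P i j| ^+ 4.
Proof.
have kR : 0 < k%:R :> F by rewrite ltr0n.
have k1 : 0 < k%:R * (k%:R + 2) :> F by rewrite mulr_gt0 // addr_gt0.
have -> : \sum_i \sum_j w i * w j * `|P i j| ^+ 4 = \sum_i \sum_j w i * w j *
    `|\sum_p theta (P p.1 i * P p.2 i) * (P p.1 j * P p.2 j)| ^+ 2.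
  apply: eq_bigr => i _; apply: eq_bigr => j _.
  by rewrite sum_square normrX -exprM.
have three_gt0 : 0 < 3 :> F by rewrite ltr0n.
rewrite -(ler_pM2l three_gt0) 2!(mulrA 3) -(expr2 3) -exprMn mulr_sumr.
under eq_bigr do rewrite mulrCA.
apply: weighted_gram_bound sum_tensor2 => // [i||i].
- by rewrite mulr_ge0 // exprn_ge0 // proj_diag_ge0.
- by rewrite mulr_gt0.
transitivity (\sum_(p : 'I_n * 'I_n)
    (2 * (P i p.1 * P p.1 i * (P i p.2 * P p.2 i)) +
     P i i * (P p.1 i * P p.2 i * P p.1 p.2))).
  apply: eq_bigr => p _.
  under eq_bigr do rewrite !theta_id.
  by rewrite mul_tensor (symP i p.1) (symP i p.2); ring.
rewrite big_split -!mulr_sumr /= sum_diag.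
rewrite (sum_pair_mul (fun a => P i a * P a i) (fun a => P i a * P a i)) sumP.
by ring.
Qed.

End Real.

End Welch.

(** * The entrywise norm of a projection *)

Lemma sqr_real_ge0 (x : F) : x \is Num.real -> 0 <= x ^+ 2.
Proof. by move=> xr; apply: real_exprn_even_ge0. Qed.

Lemma sum_cauchy n (r : 'I_n -> F) : (forall i, 0 <= r i) ->
  (\sum_i r i) ^+ 2 <= n%:R * \sum_i r i ^+ 2.
Proof.
move=> r0; have : 0 <= \sum_i \sum_j (r i - r j) ^+ 2.
  by do 2!apply: sumr_ge0 => ? _; apply/sqr_real_ge0/rpredB; apply: ger0_real.
have -> : \sum_i \sum_j (r i - r j) ^+ 2 =
    2 * (n%:R * \sum_i r i ^+ 2 - (\sum_i r i) ^+ 2).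
  have -> : \sum_i \sum_j (r i - r j) ^+ 2 =
      \sum_i (r i ^+ 2 * n%:R - 2 * (r i * \sum_j r j) + \sum_j r j ^+ 2).
    apply: eq_bigr => i _; rewrite !mulr_sumr -[n in n%:R]card_ord.
    rewrite -sum1_card natr_sum mulr_sumr -sumrB -big_split.
    by apply: eq_bigr => j _ /=; ring.
  rewrite big_split sumrB -mulr_sumr -!mulr_suml /= sumr_const card_ord.
  by rewrite -mulr_natl; ring.
by rewrite pmulr_rge0 ?ltr0n // subr_ge0.
Qed.

(** The majorant is applied to [u = |P i j| / (r i r j)] with [r i ^ 2 = P i i]; [kappa] is the
    constant of a Welch bound. By [c * kappa <= a] the coefficient of [(\sum_i r i) ^ 2] is
    nonnegative, so the bound [n k] of that square can be inserted. *)
Lemma proj_sum_bound n k (P : 'M[F]_n) a b c kappa :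
  P *m P = P -> P^H = P -> \tr P = k%:R -> 0 <= b -> 0 <= c -> c * kappa <= a ->
  (forall u, 0 <= u <= 1 -> u <= a + b * u ^+ 2 - c * u ^+ 4) ->
  (forall w : 'I_n -> F, (forall i, 0 <= w i) ->
    kappa * (\sum_i w i * P i i ^+ 2) ^+ 2 <=
      \sum_i \sum_j w i * w j * `|P i j| ^+ 4) ->
  \sum_i \sum_j `|P i j| <= ((a - c * kappa) * k%:R + b) * n%:R.
Proof.
move=> PP PH Ptr b0 c0 cka Hf HW.
have P0 i : 0 <= P i i := proj_diag_ge0 PP PH i.
(* If [r i = 0] then [x i = 0] as well, and so is the whole row [P i]. *)
pose r i := sq (P i i); pose x i := (r i)^-1.
have r0 i : 0 <= r i by apply: sq_ge0.
have x0 i : 0 <= x i by rewrite invr_ge0.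
have rE i : r i ^+ 2 = P i i by apply: sqK.
have Pr i j : `|P i j| <= r i * r j.
  rewrite -(@ler_pXn2r _ 2) ?nnegrE ?mulr_ge0 // exprMn !rE.
  exact: proj_cauchy.
have pointwise i j : `|P i j| <= a * (r i * r j) +
    b * (`|P i j| ^+ 2 * (x i * x j)) - c * (x i ^+ 3 * x j ^+ 3 * `|P i j| ^+ 4).
  have [rr|rrN] := eqVneq (r i * r j) 0.
    have -> : `|P i j| = 0 by apply: le_anti; rewrite normr_ge0 -rr Pr.
    by rewrite rr !expr0n /= !mulr0 mul0r !mulr0 addr0 subr0.
  have rr_gt0 : 0 < r i * r j by rewrite lt_def rrN mulr_ge0.
  pose u := `|P i j| / (r i * r j).
  have uE : `|P i j| = u * (r i * r j) by rewrite divfK.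
  have /Hf : 0 <= u <= 1 by rewrite divr_ge0 ?mulr_ge0 //= ler_pdivrMr // mul1r.
  move=> /(ler_wpM2r (ltW rr_gt0)); rewrite -uE => /le_trans; apply.
  move: rrN; rewrite mulf_eq0 negb_or => /andP[ri rj].
  rewrite le_eqVlt uE /x; apply/orP; left; apply/eqP; field.
  by rewrite ri rj.
pose s := \sum_i r i.
have s2 : s ^+ 2 <= n%:R * k%:R.
  by apply: le_trans (sum_cauchy r0) _; under eq_bigr do rewrite rE; rewrite -Ptr.
(* AM-GM bounds [x i * x j] by the mean of the squares; [|P i j| ^ 2 * x i ^ 2] sums to at most 1
   over row [i]. *)
have second : \sum_i \sum_j `|P i j| ^+ 2 * (x i * x j) <= n%:R.
  have half : \sum_i \sum_j `|P i j| ^+ 2 * x i ^+ 2 <= n%:R.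
    rewrite -[n in n%:R]card_ord -sum1_card natr_sum; apply: ler_sum => i _.
    rewrite -mulr_suml -proj_diag // -rE -exprMn /x.
    have [->|ri] := eqVneq (r i) 0; first by rewrite mul0r expr0n ler01.
    by rewrite divff // expr1n.
  have half' : \sum_i \sum_j `|P i j| ^+ 2 * x j ^+ 2 <= n%:R.
    rewrite exchange_big; apply: le_trans half.
    apply: ler_sum => i _; apply: ler_sum => j _.
    by rewrite (proj_normC PH).
  have two_gt0 : 0 < 2 :> F by rewrite ltr0n.
  rewrite -(ler_pM2l two_gt0); apply: le_trans (_ : n%:R + n%:R <= _); last first.
    by rewrite mulrDl !mul1r.
  apply: le_trans (lerD half half').
  rewrite mulr_sumr -big_split; apply: ler_sum => i _.
  rewrite mulr_sumr -big_split; apply: ler_sum => j _ /=.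
  rewrite -mulrDr mulrCA ler_wpM2l ?exprn_ge0 //.
  have : 0 <= (x i - x j) ^+ 2.
    by apply/sqr_real_ge0/rpredB; apply: ger0_real.
  have -> : (x i - x j) ^+ 2 = x i ^+ 2 + x j ^+ 2 - 2 * (x i * x j) by ring.
  by rewrite subr_ge0.
(* The Welch bound with weights [x i ^+ 3], for which the weighted sum of [P i i ^+ 2] is [s]. *)
have fourth : kappa * s ^+ 2 <=
    \sum_i \sum_j x i ^+ 3 * x j ^+ 3 * `|P i j| ^+ 4.
  have -> : s = \sum_i x i ^+ 3 * P i i ^+ 2.
    apply: eq_bigr => i _; rewrite -rE /x.
    have [->|ri] := eqVneq (r i) 0; first by rewrite !expr0n mulr0.
    by field.
  by apply: HW => i; apply: exprn_ge0.
apply: (@le_trans _ _ (a * s ^+ 2 + b * n%:R - c * (kappa * s ^+ 2))).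
  apply: le_trans (_ : _ <= a * s ^+ 2 +
    b * (\sum_i \sum_j `|P i j| ^+ 2 * (x i * x j)) -
    c * (\sum_i \sum_j x i ^+ 3 * x j ^+ 3 * `|P i j| ^+ 4)) _; last first.
    by rewrite lerB ?ler_wpM2l // lerD2l ler_wpM2l.
  rewrite /s expr2 big_distrlr !mulr_sumr -big_split -sumrB.
  apply: ler_sum => i _; rewrite !mulr_sumr -big_split -sumrB.
  exact: ler_sum.
have -> : a * s ^+ 2 + b * n%:R - c * (kappa * s ^+ 2) =
  (a - c * kappa) * s ^+ 2 + b * n%:R by ring.
rewrite [leRHS]mulrDl lerD2r -mulrA (mulrC k%:R); apply: ler_wpM2l => //.
by rewrite subr_ge0.
Qed.

(* The majorant minus [u] has a double root at [be] and a simple root at 1. *)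
Lemma quartic_majorant (be c : F) : 0 < be -> c * (2 * be * (1 + be) ^+ 2) = 1 ->
  forall u, 0 <= u <= 1 ->
    u <= c * be ^+ 2 * (2 * be + 1) + c * (3 * be ^+ 2 + 2 * be + 1) * u ^+ 2
         - c * u ^+ 4.
Proof.
move=> be0 cE u /andP[u0 u1].
have c0 : 0 <= c.
  have D0 : 0 < 2 * be * (1 + be) ^+ 2.
    by rewrite !mulr_gt0 ?exprn_gt0 ?addr_gt0 ?ltr0n.
  by rewrite -(pmulr_lge0 _ D0) cE ler01.
rewrite -subr_ge0.
(* The fourth root [- (2 * be + 1)] cancels the cubic term; [cE] makes the linear coefficient
   [-1]. *)
have -> : c * be ^+ 2 * (2 * be + 1) + c * (3 * be ^+ 2 + 2 * be + 1) * u ^+ 2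
    - c * u ^+ 4 - u = c * ((u - be) ^+ 2 * (1 - u) * (u + 2 * be + 1)).
  transitivity (c * be ^+ 2 * (2 * be + 1) + c * (3 * be ^+ 2 + 2 * be + 1)
      * u ^+ 2 - c * u ^+ 4 - c * (2 * be * (1 + be) ^+ 2) * u).
    by rewrite cE mul1r.
  by ring.
have be_ge0 := ltW be0.
apply: mulr_ge0 => //; apply: mulr_ge0; last first.
  by rewrite !addr_ge0 ?mulr_ge0 ?ler0n.
apply: mulr_ge0; last by rewrite subr_ge0.
by apply/sqr_real_ge0/rpredB; apply: ger0_real.
Qed.

(** * Maximal systems of equiangular lines *)

Lemma inner_conj n (u v : 'rV[F]_n) : theta (inner theta u v) = inner theta v u.
Proof.
rewrite !inner_sum rmorph_sum; apply: eq_bigr => j _.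
by rewrite rmorphM thetaK mulrC.
Qed.

(** Equality in Cauchy-Schwarz: [u - <u, v> v] has squared norm [1 - |<u, v>| ^ 2 = 0]. *)
Lemma unit_inner_submx n (u v : 'rV[F]_n) : inner theta u u = 1 ->
  inner theta v v = 1 -> `|inner theta u v| ^+ 2 = 1 -> (u <= v)%MS.
Proof.
move=> uu vv uv1; pose e := inner theta u v.
suff /subr0_eq -> : u - e *: v = 0 by apply: scalemx_sub.
apply: mul_adj_eq0; apply/matrixP => i j; rewrite !ord1 -innerE mxE.
transitivity (inner theta u u - theta e * inner theta u v
    - e * inner theta v u + e * theta e * inner theta v v).
  rewrite !inner_sum !mulr_sumr -!sumrB -big_split; apply: eq_bigr => l _ /=.
  by rewrite !mxE rmorphB rmorphM /=; ring.
rewrite uu vv -(inner_conj u v) mulr1 (mulrC (theta _)) thetaM -/e uv1; ring.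
Qed.

Lemma rank1_form n (u v : 'rV[F]_n) :
  (u *m (v^H *m v) *m u^H) 0 0 = `|inner theta u v| ^+ 2.
Proof.
rewrite mulmxA [u *m v^H]mx11_scalar mul_scalar_mx -scalemxAl mxE -!innerE.
by rewrite -(inner_conj u v) thetaM.
Qed.

Section Equiangular.
Variables (N k : nat) (x : 'I_N -> 'rV[F]_k) (b2 : F).
Variable (f : 'I_N -> 'I_k * 'I_k).
Hypotheses (N_gt0 : (0 < N)%N) (k_gt0 : (0 < k)%N).
Hypothesis x_unit : forall i, inner theta (x i) (x i) = 1.
Hypothesis x_angle : forall i j, i != j -> `|inner theta (x i) (x j)| ^+ 2 = b2.
Hypothesis b2N1 : b2 != 1.

Definition proj_comb (c : 'I_N -> F) : 'M[F]_k :=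
  \sum_i c i *: ((x i)^H *m x i).

(* The [N] coordinates singled out by [f] determine the combinations of the
   rank-one projections [(x i)^H *m x i] and of the identity. *)
Hypothesis f_coord : forall c t,
  (forall m, proj_comb c (f m).1 (f m).2 = (t%:M : 'M_k) (f m).1 (f m).2) ->
  proj_comb c = t%:M.

Let comb_angle c t j : proj_comb c = t%:M -> c j * (1 - b2) + b2 * \sum_i c i = t.
Proof.
move=> cE.
have : (x j *m proj_comb c *m (x j)^H) 0 0 = t.
  by rewrite cE mul_mx_scalar -scalemxAl mxE -innerE x_unit mulr1.
move=> <-; rewrite mulmx_sumr mulmx_suml summxE.
rewrite (bigD1 j) //= [in RHS](bigD1 j) //=.
rewrite [b2 * _]mulrDr mulr_sumr addrA; congr (_ + _).
  by rewrite -scalemxAr -scalemxAl mxE rank1_form x_unit normr1 expr1n; ring.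
apply: eq_bigr => i ij; rewrite -scalemxAr -scalemxAl mxE rank1_form.
by rewrite x_angle 1?eq_sym // mulrC.
Qed.

Let comb_tr c t : proj_comb c = t%:M -> \sum_i c i = t * k%:R.
Proof.
move=> /(congr1 mxtrace); rewrite mxtrace_scalar mulr_natr => <-.
rewrite raddf_sum /=; apply: eq_bigr => i _.
by rewrite mxtraceZ mxtrace_mulC trace_mx11 -innerE x_unit mulr1.
Qed.

Let B : 'M[F]_N := \matrix_(i, m) ((x i)^H *m x i) (f m).1 (f m).2.

Let mulB (v : 'rV_N) m : (v *m B) 0 m = proj_comb (v 0) (f m).1 (f m).2.
Proof.
by rewrite mxE summxE; apply: eq_bigr => i _; rewrite !(mxE _ _ i) !mxE.
Qed.

(** A kernel vector gives a vanishing combination; its coefficients sum to 0 by the trace, and each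
    is then 0 by [comb_angle], as [b2 != 1]. *)
Let B_unit : B \in unitmx.
Proof.
rewrite -row_free_unit -kermx_eq0; apply/rowV0P => v /sub_kermxP vB.
have vZ : proj_comb (v 0) = 0%:M.
  by apply: f_coord => m; rewrite -mulB vB !mxE mul0rn.
apply/rowP => j; rewrite [RHS]mxE; have := comb_angle j vZ.
rewrite (comb_tr vZ) mul0r mulr0 addr0 => /eqP.
by rewrite mulf_eq0 subr_eq0 [1 == _]eq_sym (negPf b2N1) orbF => /eqP.
Qed.

(** Inverting [B] expands the identity in the rank-one projections; [comb_angle] forces equal
    coefficients, and the trace then yields both their value and [b2]. *)
Lemma equiangular_tight : \sum_i (x i)^H *m x i = (N%:R / k%:R)%:M /\
  b2 * (k%:R * (N%:R - 1)) = N%:R - k%:R.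
Proof.
pose e : 'rV[F]_N := \row_m (1%:M : 'M_k) (f m).1 (f m).2.
pose v := e *m invmx B.
have vZ : proj_comb (v 0) = 1%:M.
  by apply: f_coord => m; rewrite -mulB /v mulmxKV // mxE.
have kN0 : k%:R != 0 :> F by rewrite pnatr_eq0 -lt0n.
have NN0 : N%:R != 0 :> F by rewrite pnatr_eq0 -lt0n.
have b2N0 : 1 - b2 != 0 by rewrite subr_eq0 eq_sym.
pose c := (1 - b2 * k%:R) / (1 - b2).
have vE j : v 0 j = c.
  have := comb_angle j vZ; rewrite (comb_tr vZ) mul1r => /(canRL (addrK _)) E.
  by rewrite /c -E mulfK.
have cN : c * N%:R = k%:R.
  have := comb_tr vZ; rewrite mul1r => <-; under eq_bigr do rewrite vE.
  by rewrite sumr_const card_ord mulr_natr.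
have cN0 : c != 0 by apply: contra kN0 => /eqP c0; rewrite -cN c0 mul0r.
split.
  apply: (scalerI cN0); rewrite scale_scalar_mx mulrA cN divff // -vZ.
  by rewrite scaler_sumr; apply: eq_bigr => i _; rewrite vE.
move: cN; rewrite /c => /(congr1 ( *%R^~ (1 - b2))); rewrite mulrAC divfK // => E.
apply/eqP; rewrite -subr_eq0; apply/eqP.
transitivity (k%:R * (1 - b2) - (1 - b2 * k%:R) * N%:R); first by ring.
by rewrite -E subrr.
Qed.

End Equiangular.

(** * The extremal configuration *)

Lemma sum_modn (V : nmodType) n m N (h : nat -> V) : n = (m * N)%N ->
  \sum_(i < n) h (i %% N)%N = (\sum_(t < N) h t) *+ m.
Proof.
move=> ->; elim: m => [|m IHm]; first by rewrite mul0n big_ord0.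
rewrite mulSn big_split_ord mulrS -IHm /=; congr (_ + _).
  by apply: eq_bigr => i _; rewrite modn_small.
by apply: eq_bigr => i _; rewrite modnDl.
Qed.

Lemma orth_idem_mul n (U V : 'M[F]_n) a b a' b' :
  U *m U = U -> V *m V = V -> U *m V = 0 -> V *m U = 0 ->
  (a *: U + b *: V) *m (a' *: U + b' *: V) = (a * a') *: U + (b * b') *: V.
Proof.
move=> UU VV UV VU.
rewrite mulmxDl !mulmxDr -!scalemxAl -!scalemxAr UU VV UV VU !scaler0.
by rewrite addr0 add0r !scalerA.
Qed.

Section Construction.
Variables (N k m d : nat) (x : 'I_N -> 'rV[F]_k) (b eps : F).
Hypotheses (N_gt0 : (0 < N)%N) (k_gt0 : (0 < k)%N) (m_gt0 : (0 < m)%N).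
Hypothesis nE : (d + k)%N = (m * N)%N.
Hypothesis x_unit : forall i, inner theta (x i) (x i) = 1.
Hypothesis x_angle : forall i j, i != j -> `|inner theta (x i) (x j)| = b.
Hypothesis x_tight : \sum_i (x i)^H *m x i = (N%:R / k%:R)%:M.
Hypotheses (b_gt0 : 0 < b) (eps_gt0 : 0 < eps).
(** The equation for [eps] under which the entries of [A] below have modulus [eps] both between
    copies of one line and between distinct lines. *)
Hypothesis b_eps :
  (1 + eps) * b = eps * (m%:R * N%:R / k%:R - (1 - b) * m%:R).
Local Notation n := (d + k)%N.

(** Index [i] carries the line [i %% N], so each line occurs [m] times; [E] is the incidence matrix,
    and the rows of [X] are the repeated lines. *)
Let g (i : 'I_n) : 'I_N := Ordinal (ltn_pmod i N_gt0).
Let E : 'M[F]_(n, N) := \matrix_(i, t) (g i == t)%:R.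
Let X0 : 'M[F]_(N, k) := \matrix_i x i.
Let X := E *m X0.
Let mu : F := m%:R * (N%:R / k%:R).

Let mR : m%:R != 0 :> F. Proof. by rewrite pnatr_eq0 -lt0n. Qed.
Let kR : k%:R != 0 :> F. Proof. by rewrite pnatr_eq0 -lt0n. Qed.

Let mu_gt0 : 0 < mu.
Proof. by rewrite mulr_gt0 ?divr_gt0 ?ltr0n. Qed.

Let muN0 : mu != 0. Proof. exact: lt0r_neq0. Qed.

Let EE : E^H *m E = m%:R%:M.
Proof.
apply/matrixP => s t; rewrite !mxE.
transitivity (\sum_(i < n)
    ((i %% N)%N == s :> nat)%:R * ((i %% N)%N == t :> nat)%:R : F).
  by apply: eq_bigr => i _; rewrite !mxE rmorph_nat.
rewrite (sum_modn (fun i => (i == s :> nat)%:R * (i == t :> nat)%:R : F) nE).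
rewrite (bigD1 s) //= eqxx mul1r big1 => [|i /negPf iNs]; last first.
  by rewrite (_ : (i == s :> nat) = false) ?mul0r.
by rewrite addr0 -!mulrnA mulnC.
Qed.

Let X0X0 : X0^H *m X0 = (N%:R / k%:R)%:M.
Proof.
rewrite -x_tight; apply/matrixP => a c; rewrite mxE summxE; apply: eq_bigr => i _.
by rewrite !mxE big_ord1 !mxE.
Qed.

Let XX : X^H *m X = mu%:M.
Proof.
rewrite adjM mulmxA -(mulmxA _ _ E) EE mul_mx_scalar -scalemxAl X0X0.
by rewrite scale_scalar_mx.
Qed.

(** [J] projects onto the vectors constant on the copies of each line, [Q] onto the column space of
    [X], which lies among them. *)
Let J := m%:R^-1 *: (E *m E^H).
Let Q := mu^-1 *: (X *m X^H).

Let JE : J *m E = E.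
Proof.
rewrite /J -scalemxAl -mulmxA EE mul_mx_scalar scalerA mulVf //.
by rewrite scale1r.
Qed.

Let JX : J *m X = X. Proof. by rewrite mulmxA JE. Qed.

Let JJ : J *m J = J.
Proof. by rewrite {2}/J -scalemxAr mulmxA JE. Qed.

Let QX : Q *m X = X.
Proof.
by rewrite -scalemxAl -mulmxA XX mul_mx_scalar scalerA mulVf // scale1r.
Qed.

Let JH : J^H = J.
Proof. by rewrite /J linearZ map_mxZ /= fmorphV rmorph_nat adjM adjK. Qed.

Let QH : Q^H = Q.
Proof.
rewrite /Q linearZ map_mxZ /= fmorphV (theta_ge0 (ltW mu_gt0)).
by rewrite adjM adjK.
Qed.

Let QQ : Q *m Q = Q.
Proof. by rewrite {2}/Q -scalemxAr mulmxA QX. Qed.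

Let JQ : J *m Q = Q.
Proof. by rewrite {1}/Q -scalemxAr mulmxA JX. Qed.

Let QJ : Q *m J = Q.
Proof. by rewrite -{1}QH -JH -adjM JQ. Qed.

(** [U], [V] and [Q] are mutually orthogonal projections with sum 1. *)
Let U : 'M[F]_n := 1%:M - J.
Let V : 'M[F]_n := J - Q.

Let UU : U *m U = U.
Proof. by rewrite /U mulmxBl mul1mx mulmxBr mulmx1 JJ subrr subr0. Qed.
Let VV : V *m V = V.
Proof. by rewrite /V mulmxBl !mulmxBr JJ JQ QJ QQ subrr subr0. Qed.
Let UV : U *m V = 0.
Proof. by rewrite /U /V mulmxBl mul1mx mulmxBr JJ JQ subrr. Qed.
Let VU : V *m U = 0.
Proof. by rewrite /U /V mulmxBr mulmx1 mulmxBl JJ QJ subrr. Qed.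
Let UX : U *m X = 0. Proof. by rewrite mulmxBl mul1mx JX subrr. Qed.
Let VX : V *m X = 0. Proof. by rewrite mulmxBl JX QX subrr. Qed.

Let UH : U^H = U.
Proof. by rewrite /U linearB map_mxB /= trmx1 map_mx1 JH. Qed.
Let VH : V^H = V. Proof. by rewrite /V linearB map_mxB /= JH QH. Qed.

(** Chosen so that [lam / mu = eps / b], which scales the Gram entries between distinct lines to
    modulus [eps]. *)
Let lam := eps * mu / b.
Let A := (1 + eps) *: U + lam *: V.

Let bN0 : b != 0. Proof. exact: lt0r_neq0. Qed.

Let eps1_gt0 : 0 < 1 + eps. Proof. by rewrite addr_gt0 // ltr01. Qed.
Let lam_gt0 : 0 < lam.
Proof. by rewrite /lam divr_gt0 // mulr_gt0. Qed.

Let rankX : \rank X = k.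
Proof.
apply/eqP; rewrite eqn_leq rank_leq_col /=.
have rmu : \rank (mu%:M : 'M[F]_k) = k.
  by rewrite -scalemx1 mxrank_scale_nz ?mxrank1.
by apply: (leq_trans (eq_leq (esym rmu))); rewrite -XX mxrankM_maxr.
Qed.

Let rank_le (B : 'M[F]_n) : B *m X = 0 -> (\rank B <= d)%N.
Proof. by move/mulmx0_rank_max; rewrite rankX leq_add2r. Qed.

Let rankA : \rank A = d.
Proof.
apply/eqP; rewrite eqn_leq rank_le /=; last first.
  by rewrite /A mulmxDl -!scalemxAl UX VX !scaler0 addr0.
(* [A'] inverts [A] on the range of [1 - Q], so [A] has rank at least [n - k = d]. *)
pose A' := (1 + eps)^-1 *: U + lam^-1 *: V.
have AA' : A *m A' = 1%:M - Q.
  rewrite orth_idem_mul // !mulfV ?lt0r_neq0 // !scale1r /U /V.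
  by rewrite addrA subrK.
have : (\rank (A *m A' + Q)%R <= \rank A + k)%N.
  apply: leq_trans (mxrank_add _ _) (leq_add (mxrankM_maxl _ _) _).
  rewrite /Q; apply: leq_trans (mxrank_scale _ _) _.
  by apply: leq_trans (mxrankM_maxl _ _) _; rewrite rankX.
by rewrite AA' subrK mxrank1 leq_add2r.
Qed.

Let AE i j : A i j = (1 + eps) * (i == j)%:R +
  eps / b * ((1 - b) * (g i == g j)%:R - inner theta (x (g i)) (x (g j))).
Proof.
have EEij : (E *m E^H) i j = (g i == g j)%:R.
  rewrite mxE (bigD1 (g i)) //= big1 ?addr0 => [|t tN].
    by rewrite !mxE rmorph_nat eqxx mul1r eq_sym.
  by rewrite !mxE eq_sym (negPf tN) mul0r.
have XXij : (X *m X^H) i j = inner theta (x (g i)) (x (g j)).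
  rewrite -inner_row; congr (inner _ _ _).
    by apply/rowP => c; rewrite !mxE (bigD1 (g i)) //= big1 => [|t tN];
      rewrite !mxE ?eqxx ?mul1r ?addr0 // eq_sym (negPf tN) mul0r.
  by apply/rowP => c; rewrite !mxE (bigD1 (g j)) //= big1 => [|t tN];
    rewrite !mxE ?eqxx ?mul1r ?addr0 // eq_sym (negPf tN) mul0r.
have lamE : lam = (1 + eps) + eps * (1 - b) * m%:R / b.
  apply: (mulIf bN0); rewrite /lam divfK // mulrDl b_eps divfK // /mu; ring.
transitivity ((1 + eps) * ((i == j)%:R - m%:R^-1 * (g i == g j)%:R)
   + lam * (m%:R^-1 * (g i == g j)%:R) 
   - lam / mu * inner theta (x (g i)) (x (g j))).
  have Uij : U i j = (i == j)%:R - m%:R^-1 * (g i == g j)%:R.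
    by rewrite -EEij !mxE.
  have Vij : V i j =
      m%:R^-1 * (g i == g j)%:R - mu^-1 * inner theta (x (g i)) (x (g j)).
    by rewrite -EEij -XXij !mxE.
  by rewrite mxE [X in X + _]mxE [X in _ + X]mxE Uij Vij; ring.
have -> : lam / mu = eps / b by rewrite /lam; field; rewrite bN0 muN0.
by rewrite lamE; field; rewrite bN0 mR.
Qed.

(** By [AE] off-diagonal entries are [- eps] between copies of one line and of modulus [eps]
    otherwise; [A] is positive semidefinite because [1 + eps] and [lam] are positive. *)
Lemma equiangular_gram : exists A : 'M[F]_n,
  [/\ \rank A = d, forall i, A i i = 1, off A <= eps
    & exists Y : 'M[F]_(n, d), Y *m Y^H = A].
Proof.
exists A; split => //.
- move=> i; rewrite AE !eqxx x_unit !mulr1 (addrAC 1 (- b) (- 1)) subrr sub0r.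
  by rewrite mulrN divfK // addrK.
- apply: off_le => [|i j ij]; first exact: ltW.
  rewrite AE (negPf ij) mulr0 add0r; have [<-|gij] := eqVneq (g i) (g j).
    rewrite x_unit mulr1 (_ : _ * _ = - eps); last by field.
    by rewrite normrN gtr0_norm.
  rewrite mulr0 sub0r mulrN normrN normrM x_angle // gtr0_norm ?divr_gt0 //.
  by rewrite divfK.
(* The Hermitian square root of [A], of rank at most [d]. *)
pose B := sq (1 + eps) *: U + sq lam *: V.
have BH : B^H = B.
  rewrite /B adjD !linearZ !map_mxZ /= UH VH.
  by rewrite !theta_ge0 ?sq_ge0 ?(ltW eps1_gt0) ?(ltW lam_gt0).
have BB : B *m B^H = A.
  by rewrite BH orth_idem_mul // -!expr2 !sqK // ltW.
have [|Y YE] := @gram_factor d _ _ B.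
  by apply: rank_le; rewrite /B mulmxDl -!scalemxAl UX VX !scaler0 addr0.
by exists Y; rewrite YE.
Qed.

End Construction.

(** * The optimum *)

(** With [D = al * n - 1], the projection bound gives [off A >= 1 / D]; the relation between [al]
    and [b] makes [eps = 1 / D] admissible in [equiangular_gram]. *)
Lemma equiangular_optimum (N k m d : nat) (x : 'I_N -> 'rV[F]_k) (b al : F) :
  (0 < d)%N -> (0 < k)%N -> (k <= N)%N -> (d + k)%N = (m * N)%N ->
  (forall i, inner theta (x i) (x i) = 1) ->
  (forall i j, i != j -> `|inner theta (x i) (x j)| = b) ->
  \sum_i (x i)^H *m x i = (N%:R / k%:R)%:M ->
  0 < b -> al * (b * N%:R) = N%:R / k%:R - 1 + b ->
  (forall P : 'M[F]_(d + k), P *m P = P -> P^H = P -> \tr P = k%:R ->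
    \sum_i \sum_j `|P i j| <= al * k%:R * (d + k)%:R) ->
  is_off F d k (1 / (al * (d + k)%:R - 1)) /\
  is_theta theta d k (1 / (al * (d + k)%:R - 1)).
Proof.
move=> d_gt0 k_gt0 kN nE x_unit x_angle x_tight b_gt0 alE HS.
have N_gt0 : (0 < N)%N := leq_trans k_gt0 kN.
have m_gt0 : (0 < m)%N.
  by case: m nE => // /eqP; rewrite mul0n addn_eq0 -leqn0 leqNgt d_gt0.
have kR : 0 < k%:R :> F by rewrite ltr0n.
have kRN0 : k%:R != 0 :> F by rewrite lt0r_neq0.
have bN0 : b != 0 by rewrite lt0r_neq0.
set D := al * (d + k)%:R - 1.
have Db : D * b = m%:R * (N%:R / k%:R - 1) + (m%:R - 1) * b.
  rewrite /D nE natrM; transitivity (m%:R * (al * (b * N%:R)) - b); first by ring.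
  by rewrite alE; ring.
have D_gt0 : 0 < D.
  rewrite -(pmulr_lgt0 _ b_gt0) Db.
  have m1 : 0 <= m%:R - 1 :> F by rewrite subr_ge0 ler1n.
  (* If [k = N] the first term of [D * b] vanishes, but [d > 0] gives [m > 1]; otherwise
     [N / k > 1]. *)
  move: kN; rewrite leq_eqVlt => /predU1P[kN|kN].
    rewrite -kN divff // subrr mulr0 add0r mulr_gt0 // subr_gt0 ltr1n.
    rewrite -(ltn_pmul2r k_gt0) mul1n [in ltnRHS]kN -nE.
    by rewrite -[ltnLHS]add0n ltn_add2r.
  by rewrite ltr_pwDl ?mulr_ge0 ?(ltW b_gt0) // mulr_gt0 ?ltr0n // subr_gt0
    ltr_pdivlMr // mul1r ltr_nat.
have DN0 : D != 0 by rewrite lt0r_neq0.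
have lower (A : 'M[F]_(d + k)) :
    (\rank A <= d)%N -> (forall i, A i i = 1) -> 1 / D <= off A.
  move=> rA A1; have := off_proj_lower erefl rA A1 HS.
  have -> : al * k%:R * (d + k)%:R - k%:R = D * k%:R by rewrite /D; ring.
  by rewrite mulrA -[leLHS]mul1r ler_pM2r // ler_pdivrMr.
have eps_gt0 : 0 < 1 / D by rewrite divr_gt0.
have b_eps : (1 + 1 / D) * b = 1 / D * (m%:R * N%:R / k%:R - (1 - b) * m%:R).
  transitivity (1 / D * (D * b + b)); first by field.
  by rewrite Db; congr (_ * _); ring.
have [A [rA A1 offA [Y YA]]] := equiangular_gram N_gt0 k_gt0 m_gt0 nE x_unit
  x_angle x_tight b_gt0 eps_gt0 b_eps.
have offAE : off A = 1 / D by apply: le_anti; rewrite offA lower // rA.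
split; split.
- by exists A.
- by move=> _ [B [rB B1] <-]; apply: lower => //; rewrite rB.
- exists (fun i => row i Y); first by move=> i; rewrite inner_row YA A1.
  rewrite -offAE; congr off; apply/matrixP => i j.
  by rewrite mxE inner_row YA.
(* A Gram matrix of vectors in dimension [d] may have rank below [d]; hence the inequality in
   [lower]. *)
move=> _ [y y1 <-]; apply: lower => [|i]; last by rewrite mxE.
pose Z : 'M[F]_(d + k, d) := \matrix_i y i.
have -> : \matrix_(i, j) inner theta (y i) (y j) = Z *m Z^H.
  by apply/matrixP => i j; rewrite mxE -inner_row !rowK.
by apply: leq_trans (mxrankM_maxl _ _) (rank_leq_col _).
Qed.

Lemma ord_neq_gt1 N (i j : 'I_N) : i != j -> (1 < N)%N.
Proof.
apply: contra_neqT; rewrite -leqNgt => N_le1.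
have ord_eq0 (l : 'I_N) : l = 0%N :> nat.
  by apply/eqP; rewrite -leqn0 -ltnS (leq_trans (ltn_ord l)).
by apply: val_inj; rewrite /= !ord_eq0.
Qed.

Lemma equiangular_lines_tight N k (f : 'I_N -> 'I_k * 'I_k) :
  (0 < k)%N -> (0 < N)%N ->
  (forall (x : 'I_N -> 'rV[F]_k) c t,
    (forall m, proj_comb x c (f m).1 (f m).2 = (t%:M : 'M_k) (f m).1 (f m).2) ->
    proj_comb x c = t%:M) ->
  equiangular_lines theta k N ->
  exists x : 'I_N -> 'rV[F]_k,
  [/\ forall i, inner theta (x i) (x i) = 1,
      \sum_i (x i)^H *m x i = (N%:R / k%:R)%:M
    & forall i j, i != j ->
      `|inner theta (x i) (x j)| ^+ 2 * (k%:R * (N%:R - 1)) = N%:R - k%:R].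
Proof.
move=> k_gt0 N_gt0 f_coord [x [x1 xN [beta beta_real xb]]].
have [b2 b2N1 xb2] : exists2 b2 : F, b2 != 1 &
    forall i j, i != j -> `|inner theta (x i) (x j)| ^+ 2 = b2.
  have [N1|] := leqP N 1.
    (* A single line forms no pair, so any value other than 1 serves. *)
    exists 0 => [|i j /ord_neq_gt1]; first by rewrite eq_sym oner_eq0.
    by rewrite ltnNge N1.
  move=> N2; pose i0 := Ordinal N_gt0; pose i1 := Ordinal N2.
  exists (beta ^+ 2) => [|i j ij]; last by rewrite xb.
  have i01 : i0 != i1 by [].
  (* [beta ^+ 2 = 1] would be equality in Cauchy-Schwarz and make two of the lines coincide. *)
  apply/negP => /eqP b1; have /negP := xN _ _ i01; apply.
  by rewrite /eqmx !unit_inner_submx // xb // eq_sym.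
exists x; have [tight b2E] :=
  equiangular_tight N_gt0 k_gt0 x1 xb2 b2N1 (@f_coord x).
by split=> // i j ij; rewrite xb2.
Qed.

Lemma proj_combE N k (x : 'I_N -> 'rV[F]_k) c a b :
  proj_comb x c a b = \sum_i c i * (theta (x i 0 a) * x i 0 b).
Proof.
rewrite summxE; apply: eq_bigr => i _.
by rewrite !mxE big_ord1 !mxE.
Qed.

Lemma angle_eq (u v p q : F) : 0 <= u -> 0 <= v -> p != 0 ->
  u ^+ 2 * p = q -> v ^+ 2 * p = q -> u = v.
Proof.
move=> u0 v0 pN0 uq vq; apply: (@pexpIrn _ 2%N); rewrite ?nnegrE //.
by apply: (mulIf pN0); rewrite uq.
Qed.

(** The quartic touching [u] at [be = 1 / sqrt (k + 1)] is combined with the Welch constant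
    [2 / (k (k + 1))], written [2 * be ^+ 2 / k]. *)
Lemma complex_sum_bound n k (P : 'M[F]_n) (be : F) : (0 < k)%N ->
  P *m P = P -> P^H = P -> \tr P = k%:R -> 0 < be -> be ^+ 2 * (k%:R + 1) = 1 ->
  \sum_i \sum_j `|P i j| <=
    ((k%:R - 1) / be + 1) / k%:R ^+ 2 * k%:R * n%:R.
Proof.
move=> k_gt0 PP PH Ptr be0 beE.
have be_ge0 := ltW be0.
have kR : 0 < k%:R :> F by rewrite ltr0n.
have beN0 : be != 0 by rewrite lt0r_neq0.
have kN0 : k%:R != 0 :> F by rewrite lt0r_neq0.
have be1 : 1 + be != 0 by rewrite lt0r_neq0 ?addr_gt0 ?ltr01.
have k1 : k%:R + 1 != 0 :> F by rewrite lt0r_neq0 ?addr_gt0 ?ltr01.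
have kE : k%:R = be ^- 2 - 1 :> F.
  apply: (mulfI (expf_neq0 2 beN0)); rewrite mulrBr mulfV ?expf_neq0 // mulr1.
  by apply/eqP; rewrite eq_sym subr_eq -[X in X == _]beE; apply/eqP; ring.
pose c := (2 * be * (1 + be) ^+ 2)^-1.
have c0 : 0 < c.
  by rewrite invr_gt0 !mulr_gt0 ?exprn_gt0 ?addr_gt0 ?ltr0n ?ltr01.
have cE : c * (2 * be * (1 + be) ^+ 2) = 1.
  by rewrite mulVf // -invr_eq0 lt0r_neq0.
(* Equivalent to [c * kappa <= a]; for [k = 1] it reads [1 <= 2 * be]. *)
have half : 2 <= k%:R * (2 * be + 1).
  have [k2|] := leqP 2 k.
    rewrite -[leLHS]mulr1 ler_pM ?ler0n ?ler01 ?ler_nat // lerDr.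
    by rewrite mulr_ge0 ?ler0n.
  rewrite ltnS leq_eqVlt ltnNge k_gt0 orbF => /eqP k1'.
  rewrite k1' mul1r -lerBlDr (_ : 2 - 1 = 1); last by ring.
  rewrite -(@ler_pXn2r _ 2) ?nnegrE ?mulr_ge0 ?ler0n ?ler01 // expr1n exprMn.
  have -> : 2 ^+ 2 * be ^+ 2 = 2 * (be ^+ 2 * (k%:R + 1)) by rewrite k1'; ring.
  by rewrite beE mulr1 ler1n.
have := @proj_sum_bound n k P (c * be ^+ 2 * (2 * be + 1))
  (c * (3 * be ^+ 2 + 2 * be + 1)) c (2 * be ^+ 2 / k%:R) PP PH Ptr.
have -> : (c * be ^+ 2 * (2 * be + 1) - c * (2 * be ^+ 2 / k%:R)) * k%:R +
    c * (3 * be ^+ 2 + 2 * be + 1) = ((k%:R - 1) / be + 1) / k%:R ^+ 2 * k%:R.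
  have k0 : 1 - be ^+ 2 != 0.
    have -> : 1 - be ^+ 2 = k%:R * be ^+ 2 by rewrite -{1}beE; ring.
    by rewrite mulf_neq0 ?expf_neq0.
  by rewrite /c kE; field; rewrite beN0 be1 /= mulN1r k0.
move=> bound; apply: bound; first 1 last.
- exact: ltW.
- rewrite -[leRHS]mulrA ler_pM2l // mulrAC [leLHS]mulrC ler_wpM2l ?exprn_ge0 //.
  by rewrite ler_pdivrMr // [leRHS]mulrC.
- exact: quartic_majorant.
- move=> w w0; have := welch_complex k_gt0 w0 PP PH Ptr.
  rewrite -ler_pdivrMl ?mulr_gt0 ?addr_gt0 ?ltr01 //.
  apply: le_trans; rewrite [leRHS]mulrA ler_wpM2r //.
    rewrite exprn_ge0 // sumr_ge0 // => i _.
    by rewrite mulr_ge0 ?exprn_ge0 ?proj_diag_ge0.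
  have -> : be ^+ 2 = (k%:R + 1)^-1 by apply: (mulIf k1); rewrite mulVf.
  by rewrite le_eqVlt; apply/orP; left; apply/eqP; field; rewrite kN0 k1.
by rewrite mulr_ge0 ?(ltW c0) // !addr_ge0 ?mulr_ge0 ?exprn_ge0 ?ler0n ?ler01.
Qed.

(** The tangent point is now [be = 1 / sqrt (k + 2)] and the Welch constant [3 / (k (k + 2))]. *)
Lemma real_sum_bound n k (P : 'M[F]_n) (be : F) : (forall x, theta x = x) ->
  (0 < k)%N ->
  P *m P = P -> P^H = P -> \tr P = k%:R -> 0 < be -> be ^+ 2 * (k%:R + 2) = 1 ->
  \sum_i \sum_j `|P i j| <=
    ((k%:R - 1) / be + 2) / (k%:R * (k%:R + 1)) * k%:R * n%:R.
Proof.
move=> theta_id k_gt0 PP PH Ptr be0 beE.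
have be_ge0 := ltW be0.
have kR : 0 < k%:R :> F by rewrite ltr0n.
have beN0 : be != 0 by rewrite lt0r_neq0.
have kN0 : k%:R != 0 :> F by rewrite lt0r_neq0.
have be1 : 1 + be != 0 by rewrite lt0r_neq0 ?addr_gt0 ?ltr01.
have k1 : k%:R + 1 != 0 :> F by rewrite lt0r_neq0 ?addr_gt0 ?ltr01.
have k2 : k%:R + 2 != 0 :> F by rewrite lt0r_neq0 ?addr_gt0 ?ltr0n.
have kE : k%:R = be ^- 2 - 2 :> F.
  apply: (mulfI (expf_neq0 2 beN0)); rewrite mulrBr mulfV ?expf_neq0 //.
  by apply/eqP; rewrite eq_sym subr_eq -[X in X == _]beE; apply/eqP; ring.
(* [c * kappa <= a] fails for [k = 1]; there the constant majorant 1 suffices. *)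
have [k_eq1|k_neq1] := eqVneq k 1%N.
  have := @proj_sum_bound n k P 1 0 0 0 PP PH Ptr (lexx _) (lexx _).
  have -> : (1 - 0 * 0) * k%:R + 0 =
      ((k%:R - 1) / be + 2) / (k%:R * (k%:R + 1)) * k%:R :> F.
    by rewrite k_eq1; field.
  move=> bound; apply: bound; first by rewrite mulr0 ler01.
    by move=> u /andP[_ u1]; rewrite !mul0r addr0 subr0.
  move=> w w0; rewrite mul0r; do 2!apply: sumr_ge0 => ? _.
  by rewrite !mulr_ge0 ?exprn_ge0.
pose c := (2 * be * (1 + be) ^+ 2)^-1.
have c0 : 0 < c.
  by rewrite invr_gt0 !mulr_gt0 ?exprn_gt0 ?addr_gt0 ?ltr0n ?ltr01.
have cE : c * (2 * be * (1 + be) ^+ 2) = 1.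
  by rewrite mulVf // -invr_eq0 lt0r_neq0.
(* Again [c * kappa <= a]; for [k = 2] it follows from [1 <= 2 * be]. *)
have half : 3 <= k%:R * (2 * be + 1).
  have [k3|] := leqP 3 k.
    rewrite -[leLHS]mulr1 ler_pM ?ler0n ?ler01 ?ler_nat // lerDr.
    by rewrite mulr_ge0 ?ler0n.
  rewrite ltnS leq_eqVlt ltnS leq_eqVlt (negPf k_neq1) ltnNge k_gt0 !orbF.
  move=> /eqP k_eq2.
  have be2 : 1 <= 2 * be.
    rewrite -(@ler_pXn2r _ 2) ?nnegrE ?mulr_ge0 ?ler0n ?ler01 // expr1n exprMn.
    have -> : 2 ^+ 2 * be ^+ 2 = be ^+ 2 * (k%:R + 2) by rewrite k_eq2; ring.
    by rewrite beE.
  rewrite k_eq2; apply: (@le_trans _ _ (2 * (1 + 1))).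
    by rewrite -[1 + 1]/2%:R -natrM ler_nat.
  by rewrite ler_wpM2l ?ler0n // lerD2r.
have := @proj_sum_bound n k P (c * be ^+ 2 * (2 * be + 1))
  (c * (3 * be ^+ 2 + 2 * be + 1)) c (3 * be ^+ 2 / k%:R) PP PH Ptr.
have -> : (c * be ^+ 2 * (2 * be + 1) - c * (3 * be ^+ 2 / k%:R)) * k%:R +
    c * (3 * be ^+ 2 + 2 * be + 1) =
    ((k%:R - 1) / be + 2) / (k%:R * (k%:R + 1)) * k%:R.
  have k0 : 1 - be ^+ 2 *+ 2 != 0.
    have -> : 1 - be ^+ 2 *+ 2 = k%:R * be ^+ 2 by rewrite -{1}beE; ring.
    by rewrite mulf_neq0 ?expf_neq0.
  have k1' : 1 - be ^+ 2 != 0.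
    have -> : 1 - be ^+ 2 = (k%:R + 1) * be ^+ 2 by rewrite -{1}beE; ring.
    by rewrite mulf_neq0 ?expf_neq0.
  rewrite /c kE; field; rewrite beN0 be1 /= andbT.
  have -> : 1 + - (2) * be ^+ 2 = 1 - be ^+ 2 *+ 2 by ring.
  have k1E : 1 - be ^+ 2 *+ 2 + be ^+ 2 = 1 - be ^+ 2 by ring.
  by rewrite k1E k1' k0.
move=> bound; apply: bound; first 1 last.
- exact: ltW.
- rewrite -[leRHS]mulrA ler_pM2l // mulrAC [leLHS]mulrC ler_wpM2l ?exprn_ge0 //.
  by rewrite ler_pdivrMr // [leRHS]mulrC.
- exact: quartic_majorant.
- move=> w w0; have := welch_real k_gt0 w0 PP PH Ptr theta_id.
  rewrite -ler_pdivrMl ?mulr_gt0 ?addr_gt0 ?ltr0n //.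
  apply: le_trans; rewrite [leRHS]mulrA ler_wpM2r //.
    rewrite exprn_ge0 // sumr_ge0 // => i _.
    by rewrite mulr_ge0 ?exprn_ge0 ?proj_diag_ge0.
  have -> : be ^+ 2 = (k%:R + 2)^-1 by apply: (mulIf k2); rewrite mulVf.
  by rewrite le_eqVlt; apply/orP; left; apply/eqP; field; rewrite kN0 k2.
by rewrite mulr_ge0 ?(ltW c0) // !addr_ge0 ?mulr_ge0 ?exprn_ge0 ?ler0n ?ler01.
Qed.

(** * Coordinates of Hermitian and symmetric matrices *)

Lemma enum_ord_onto (T : finType) (A : {set T}) N : #|A| = N ->
  exists f : 'I_N -> T, forall p, p \in A -> exists m, f m = p.
Proof.
move=> AN; exists (fun m => enum_val (cast_ord (esym AN) m)) => p pA.
exists (cast_ord AN (enum_rank_in pA p)).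
by rewrite cast_ordK enum_rankK_in.
Qed.

Lemma complex_coord k : exists f : 'I_(k ^ 2) -> 'I_k * 'I_k,
  forall (x : 'I_(k ^ 2) -> 'rV[F]_k) c t,
  (forall m, proj_comb x c (f m).1 (f m).2 = (t%:M : 'M_k) (f m).1 (f m).2) ->
  proj_comb x c = t%:M.
Proof.
have [|f f_onto] := @enum_ord_onto _ [set: 'I_k * 'I_k] (k ^ 2).
  by rewrite cardsT card_prod card_ord.
exists f => x c t eqf; apply/matrixP => a b.
by have [|m fm] := f_onto (a, b); [rewrite inE | have := eqf m; rewrite fm].
Qed.

Lemma card_le_pairs k : #|[set p : 'I_k * 'I_k | p.1 <= p.2]%N| = 'C(k.+1, 2).
Proof.
rewrite cardsE -sum1_card big_mkcond /=.
transitivity (\sum_(b < k) \sum_(a < k) if (a <= b)%N then 1 else 0)%N.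
  by rewrite exchange_big pair_bigA; apply: eq_bigr => p _; rewrite unfold_in.
rewrite -bin2_sum big_mkord big_ord_recl add0n; apply: eq_bigr => b _.
rewrite -big_mkcond /= -(big_ord_widen _ (fun=> 1%N) (ltn_ord b)).
by rewrite sum1_card card_ord.
Qed.

(** When [theta] is the identity, [proj_comb] is symmetric, so the entries on and above the diagonal
    suffice. *)
Lemma real_coord k : (forall x, theta x = x) ->
  exists f : 'I_('C(k.+1, 2)) -> 'I_k * 'I_k,
  forall (x : 'I_('C(k.+1, 2)) -> 'rV[F]_k) c t,
  (forall m, proj_comb x c (f m).1 (f m).2 = (t%:M : 'M_k) (f m).1 (f m).2) ->
  proj_comb x c = t%:M.
Proof.
move=> theta_id; have [f f_onto] := enum_ord_onto (card_le_pairs k).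
exists f => x c t eqf; apply/matrixP => a b.
have eq_le (i j : 'I_k) : (i <= j)%N -> proj_comb x c i j = (t%:M : 'M_k) i j.
  move=> ij; have [|m fm] := f_onto (i, j); first by rewrite inE.
  by have := eqf m; rewrite fm.
have [/eq_le //|/ltnW/eq_le ba] := leqP a b.
transitivity (proj_comb x c b a).
  rewrite !proj_combE; apply: eq_bigr => i _.
  by rewrite !theta_id [_ * x i 0 b]mulrC.
by rewrite ba !mxE eq_sym.
Qed.

Lemma complex_optimum d k (be : F) : (0 < d)%N -> (0 < k)%N -> 0 < be ->
  be ^+ 2 * (k%:R + 1) = 1 -> (k ^ 2 %| d + k)%N ->
  equiangular_lines theta k (k ^ 2) ->
  let v := 1 / (((k%:R - 1) / be + 1) / k%:R ^+ 2 * (d + k)%:R - 1) in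
  is_off F d k v /\ is_theta theta d k v.
Proof.
move=> d_gt0 k_gt0 be0 beE /dvdnP[m nE] lines /=.
have beN0 : be != 0 by rewrite lt0r_neq0.
have kN0 : k%:R != 0 :> F by rewrite pnatr_eq0 -lt0n.
have N_gt0 : (0 < k ^ 2)%N by rewrite expn_gt0 k_gt0.
have [f f_coord] := complex_coord k.
have [x [x1 tight xb]] := equiangular_lines_tight k_gt0 N_gt0 f_coord lines.
apply: (equiangular_optimum (x := x) (b := be) d_gt0 k_gt0 _ nE) => //.
- by rewrite -[leqLHS]expn1 leq_pexp2l.
(* The squared angle [(N - k) / (k (N - 1))] of the tight frame is [1 / (k + 1)] for [N = k ^ 2]. *)
- move=> i j ij; apply: angle_eq (xb i j ij) _ => //; first exact: ltW.
    by rewrite mulf_neq0 // subr_eq0 pnatr_eq1 gtn_eqF // (ord_neq_gt1 ij).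
  transitivity (be ^+ 2 * (k%:R + 1) * (k%:R ^+ 2 - k%:R)).
    by rewrite natrX; ring.
  by rewrite beE mul1r natrX.
- by rewrite natrX; field; rewrite beN0 kN0.
by move=> P PP PH Ptr; apply: complex_sum_bound.
Qed.

Lemma real_optimum d k (be : F) : (forall x, theta x = x) ->
  (0 < d)%N -> (0 < k)%N -> 0 < be ->
  be ^+ 2 * (k%:R + 2) = 1 -> ('C(k.+1, 2) %| d + k)%N ->
  equiangular_lines theta k 'C(k.+1, 2) ->
  let v := 1 / (((k%:R - 1) / be + 2) / (k%:R * (k%:R + 1)) * (d + k)%:R - 1) in
  is_off F d k v /\ is_theta theta d k v.
Proof.
move=> theta_id d_gt0 k_gt0 be0 beE /dvdnP[m nE] lines /=.
have beN0 : be != 0 by rewrite lt0r_neq0.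
have kN0 : k%:R != 0 :> F by rewrite pnatr_eq0 -lt0n.
have k1 : k%:R + 1 != 0 :> F by rewrite natr1 pnatr_eq0.
have N2 : (2 * 'C(k.+1, 2) = k.+1 * k)%N by rewrite -mul_bin_diag bin1.
have NE : 'C(k.+1, 2)%:R = k%:R * (k%:R + 1) / 2 :> F.
  have two_neq0 : 2 != 0 :> F by rewrite pnatr_eq0.
  by apply: (mulfI two_neq0); rewrite -natrM N2 natrM -natr1; field.
have N_gt0 : (0 < 'C(k.+1, 2))%N by rewrite bin_gt0.
have [f f_coord] := real_coord k theta_id.
have [x [x1 tight xb]] := equiangular_lines_tight k_gt0 N_gt0 f_coord lines.
apply: (equiangular_optimum (x := x) (b := be) d_gt0 k_gt0 _ nE) => //.
- by rewrite -(leq_pmul2l (isT : 0 < 2)%N) N2 leq_pmul2r.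
(* For [N = k (k + 1) / 2] the squared angle is [1 / (k + 2)]. *)
- move=> i j ij; apply: angle_eq (xb i j ij) _ => //; first exact: ltW.
    by rewrite mulf_neq0 // subr_eq0 pnatr_eq1 gtn_eqF // (ord_neq_gt1 ij).
  transitivity (be ^+ 2 * (k%:R + 2) * ('C(k.+1, 2)%:R - k%:R)).
    by rewrite NE; field.
  by rewrite beE mul1r.
- by rewrite NE; field; rewrite beN0 kN0 k1.
by move=> P PP PH Ptr; apply: real_sum_bound.
Qed.

End Conjugation.

(** * Specialisation to R and [R[i]] *)

Lemma dvdn_opp_mod (d k N : nat) :
  (d%:Z = - k%:Z %[mod N%:Z])%Z -> (N %| d + k)%N.
Proof. by move/eqP; rewrite eqz_mod_dvd opprK. Qed.

Theorem theorem1p3 (R : realType) (d k : nat) (d_gt0 : (0 < d)%N)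
    (k_gt0 : (0 < k)%N) :
  (equiangular_lines (idfun : {rmorphism R -> R}) k 'C(k.+1, 2) ->
   (d%:Z = - k%:Z %[mod 'C(k.+1, 2)%:Z])%Z ->
   let v : R := 1 / (alpha_real R k * (d + k)%:R - 1) in
   is_off R d k v /\ is_theta (idfun : {rmorphism R -> R}) d k v)
  /\
  (equiangular_lines (@Num.conj R[i]) k (k ^ 2)%N ->
   (d%:Z = - k%:Z %[mod (k ^ 2)%N%:Z])%Z ->
   let v : R := 1 / (alpha_complex R k * (d + k)%:R - 1) in
   is_off R[i] d k v%:C /\ is_theta (@Num.conj R[i]) d k v%:C).
Proof.
split=> lines /dvdn_opp_mod dvd v.
  have k2 : 0 < k%:R + 2 :> R by rewrite ltr_wpDl ?ltr0n.
  have s_gt0 : 0 < Num.sqrt (k%:R + 2) :> R by rewrite sqrtr_gt0.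
  have idM (x : R) : x * (idfun : {rmorphism R -> R}) x = `|x| ^+ 2.
    by rewrite -expr2 real_normK ?num_real.
  have vE : v = 1 / (((k%:R - 1) / (Num.sqrt (k%:R + 2))^-1 + 2) /
      (k%:R * (k%:R + 1)) * (d + k)%:R - 1) by rewrite invrK.
  have sq_ge0 (x : R) : 0 <= x -> 0 <= Num.sqrt x by rewrite sqrtr_ge0.
  rewrite vE; apply: (real_optimum idM sq_ge0 (@sqr_sqrtr R)) => //.
    by rewrite invr_gt0.
  by rewrite exprVn sqr_sqrtr ?(ltW k2) // mulVf // lt0r_neq0.
have k1 : 0 < k%:R + 1 :> R by rewrite ltr_wpDl.
have s_gt0 : 0 < Num.sqrt (k%:R + 1) :> R by rewrite sqrtr_gt0.
pose be : R[i] := (Num.sqrt (k%:R + 1))^-1%:C.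
have vE : v%:C = 1 / (((k%:R - 1) / be + 1) / k%:R ^+ 2 * (d + k)%:R - 1).
  rewrite /v /alpha_complex /be.
  rewrite !(rmorphM, rmorphD, rmorphN, fmorphV, rmorph1, rmorphXn, rmorph_nat).
  by rewrite /= invrK.
have sq_ge0 (x : R[i]) : 0 <= x -> 0 <= sqrtC x by rewrite sqrtC_ge0.
rewrite vE; apply: (complex_optimum _ sq_ge0 (fun x _ => sqrtCK x)) => //.
- by move=> x; rewrite normCK.
- by rewrite /be ltcR invr_gt0.
rewrite /be -rmorphXn exprVn sqr_sqrtr ?(ltW k1) //.
have -> : (k%:R + 1 : R[i]) = (k%:R + 1)%:C by rewrite rmorphD rmorph1 rmorph_nat.
by rewrite -rmorphM mulVf ?rmorph1 // lt0r_neq0.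
Qed.
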